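(* Assume that the joint-observation space $\mathcal{O}$ is finite. Then the sets of occupation measures generated by joint mixtures of decentralized pure policy-profiles and by mixtures of pure coordination policies coincide: $$\mathbf{p}_\infty^{(1)}\big(\mathcal{M}_1(\mathcal{U}_{\mathrm{pure}})\big)=\mathbf{p}_\infty^{(1)}\big(\mathcal{M}_1(\mathcal{V}_{\mathrm{pure}})\big).$$
   Context: Model. $N\in\mathbb{N}$ agents. The state space $\mathcal{S}$ is a topological space with Borel $\sigma$-algebra $\mathcal{B}(\mathcal{S})$. The joint-observation space is $\mathcal{O}=\mathcal{O}^{(0)}\times\mathcal{O}^{(1)}\times\cdots\times\mathcal{O}^{(N)}$, discrete ($\mathcal{O}^{(0)}$: common observations; $\mathcal{O}^{(n)}$: private observations of agent $n$). The joint-action space $\mathcal{A}=\mathcal{A}^{(1)}\times\cdots\times\mathcal{A}^{(N)}$ is finite and discrete. The initial pair $(S_1,O_1)$ has law $P_1$, a probability measure on $\mathcal{S}\times\mathcal{O}$. Given all past states, observations and actions, and the current $S_t=s$, $A_t=a$, one has $\mathbb{P}(S_{t+1}\in B,O_{t+1}=o\mid\cdot)=P(s,a,B,o)$ for $B\in\mathcal{B}(\mathcal{S})$, $o\in\mathcal{O}$, where $P$ is a fixed transition probability, measurable in $(s,a,o)$ for each $B$. At time $t\in\mathbb{N}$ agent $n$ observes $O_t^{(0)}$ and $O_t^{(n)}$ and then chooses $A_t^{(n)}\in\mathcal{A}^{(n)}$; actions are forever private. Histories. The common history at time $t$ is $h_t^{(0)}=o^{(0)}_{1:t}\in\mathcal{H}_t^{(0)}=(\mathcal{O}^{(0)})^t$.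 The private history of agent $n$ is $h_t^{(n)}=(o^{(n)}_{1:t},a^{(n)}_{1:t-1})\in\mathcal{H}_t^{(n)}=(\mathcal{O}^{(n)})^t\times(\mathcal{A}^{(n)})^{t-1}$. The joint-history is $h_t=(o_{1:t},a_{1:t-1})=(h_t^{(0)},h_t^{(1)},\dots,h_t^{(N)})\in\mathcal{H}_t$. Write $h_t^{(0,n)}=(h_t^{(0)},h_t^{(n)})\in\mathcal{H}_t^{(0,n)}=\mathcal{H}_t^{(0)}\times\mathcal{H}_t^{(n)}$. Decentralized policies. $\mathcal{M}_1(Y)$ denotes the set of Borel probability measures on $Y$. A behavioral policy of agent $n$ is $u^{(n)}=(u^{(n)}_t)_{t\ge1}\in\mathcal{U}^{(n)}$ with $u^{(n)}_t:\mathcal{H}_t^{(0,n)}\to\mathcal{M}_1(\mathcal{A}^{(n)})$; it is pure if every $u_t^{(n)}(h_t^{(0,n)})$ is a Dirac measure, and $\mathcal{U}^{(n)}_{\mathrm{pure}}$ is the set of pure policies. $\mathcal{U}=\prod_{n=1}^N\mathcal{U}^{(n)}$, $\mathcal{U}_{\mathrm{pure}}=\prod_{n=1}^N\mathcal{U}^{(n)}_{\mathrm{pure}}$. Under $u\in\mathcal{U}$, given $h_t$, the joint action $a_t$ is chosen with probability $\prod_{n=1}^N u^{(n)}_t(a^{(n)}_t\mid h^{(0,n)}_t)$ (independently of the current and past states given $h_t$); $\mathbb{P}^{u}_{P_1}$ is the resulting law of $(S_t,O_t,A_t)_{t\ge1}$. $\mathcal{U}$ is identified with $\prod_{n}\prod_{t\ge1}\prod_{h\in\mathcal{H}_t^{(0,n)}}\mathcal{M}_1(\mathcal{A}^{(n)})$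 with the product of the weak topologies; $\mathcal{U}_{\mathrm{pure}}$ has the subspace topology. Coordination policies. A prescription at time $t$ is a tuple $\gamma_t=(\gamma_t^{(1)},\dots,\gamma_t^{(N)})$ of maps $\gamma_t^{(n)}:\mathcal{H}_t^{(n)}\to\mathcal{A}^{(n)}$; $\mathcal{G}_t$ is the set of prescriptions at time $t$ (a finite set when $\mathcal{O}$ is finite). A coordinator, who at time $t$ knows the prescription-observation history $\tilde h_t^{(0)}=(o_{1:t}^{(0)},\gamma_{1:t-1})\in\tilde{\mathcal{H}}_t^{(0)}=\mathcal{H}_t^{(0)}\times\mathcal{G}_1\times\cdots\times\mathcal{G}_{t-1}$, chooses $\Gamma_t\in\mathcal{G}_t$, and each agent then plays $A_t^{(n)}=\Gamma_t^{(n)}(H_t^{(n)})$. A behavioral coordination policy is $v=(v_t)_{t\ge1}\in\mathcal{V}$ with $v_t:\tilde{\mathcal{H}}_t^{(0)}\to\mathcal{M}_1(\mathcal{G}_t)$ Borel measurable, so that $\Gamma_t\sim v_t(\tilde H_t^{(0)})$; it is pure if every $v_t(\tilde h_t^{(0)})$ is a Dirac measure, and $\mathcal{V}_{\mathrm{pure}}\subseteq\mathcal{V}$ is the set of pure coordination policies. $\mathbb{P}^{v}_{P_1}$ is the resulting law of $(S_t,O_t,\Gamma_t,A_t)_{t\ge1}$. $\mathcal{V}$ is identified with $\prod_{t\ge1}\prod_{\tilde h\in\tilde{\mathcal{H}}_t^{(0)}}\mathcal{M}_1(\mathcal{G}_t)$ with the product of the weak topologies; $\mathcal{V}_{\mathrm{pure}}$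 has the subspace topology. Mixtures. For $\mu\in\mathcal{M}_1(\mathcal{U}_{\mathrm{pure}})$ (respectively $\nu\in\mathcal{M}_1(\mathcal{V}_{\mathrm{pure}})$) a policy-profile (respectively coordination policy) is drawn at time $0$ and then used forever, so $\mathbb{P}^{\mu}_{P_1}(h_t,a_t)=\int\mathbb{P}^{u}_{P_1}(h_t,a_t)\,\mu(du)$ and $\mathbb{P}^{\nu}_{P_1}(h_t,a_t)=\int\mathbb{P}^{v}_{P_1}(h_t,a_t)\,\nu(dv)$. Occupation measures. For a mixture $x$, $\mathbf{p}_\infty^{(1)}(x)=\{\mathbb{P}^{x}_{P_1}(h_t,a_t): t\in\mathbb{N},h_t\in\mathcal{H}_t,a_t\in\mathcal{A}\}$, viewed as a function (measure) on $\bigcup_{t\ge1}(\mathcal{H}_t\times\mathcal{A})$. For a set $X$, $\mathbf{p}_\infty^{(1)}(X)=\{\mathbf{p}_\infty^{(1)}(x):x\in X\}$. *)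

(* Defs.v *)
From HB Require Import structures.
From mathcomp Require Import all_boot all_order all_algebra.
From mathcomp Require Import all_classical all_reals all_analysis.
From mathcomp Require Import measurable_realfun.

Set Implicit Arguments.
Unset Strict Implicit.
Unset Printing Implicit Defensive.

Import Order.TTheory GRing.Theory Num.Theory.
Import numFieldNormedType.Exports.

Local Open Scope classical_set_scope.
Local Open Scope ring_scope.

(* Measurable types are pointed in the library, so the finite sets of the model
   are finite types with a distinguished element, i.e. nonempty. *)
#[short(type="nefinType")]
HB.structure Definition NonemptyFinite := {T of Finite T & Pointed T}.

HB.instance Definition _ := Pointed.on unit.
HB.instance Definition _ (T1 T2 : nefinType) := Pointed.on (T1 * T2)%type.
HB.instance Definition _ n (T : nefinType) := Pointed.on (n.-tuple T).
HB.instance Definition _ (I : finType) (T : I -> nefinType) :=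
  isPointed.Build {dffun forall i, T i} [ffun i => point].
HB.instance Definition _ (I : finType) (T : nefinType) :=
  isPointed.Build {ffun I -> T} [ffun => point].

(* A discrete space with its Borel sigma-algebra, the power set. *)
Definition discrete (T : Type) : Type := T.

HB.instance Definition _ (T : pointedType) := Pointed.on (discrete T).
HB.instance Definition _ (T : pointedType) :=
  @isMeasurable.Build default_measure_display (discrete T)
    discrete_measurable discrete_measurable0
    discrete_measurableC discrete_measurableU.

Definition borel (X : ptopologicalType) := g_sigma_algebraType (@open X).
HB.instance Definition _ (X : ptopologicalType) :=
  Measurable.on (borel X).

Lemma measurable_from_discrete d (T : pointedType) (Y : measurableType d)
    (f : discrete T -> Y) : measurable_fun [set: discrete T] f.
Proof. by []. Qed.

Lemma measurable_discrete_pair d (X : measurableType d) (Y Z : nefinType)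
    (T : pointedType) (f : X -> discrete Y) (g : X -> discrete Z)
    (h : Y -> Z -> discrete T) :
  measurable_fun [set: X] f -> measurable_fun [set: X] g ->
  measurable_fun [set: X] (fun x => h (f x) (g x)).
Proof.
move=> mf mg _ B _; rewrite setTI.
rewrite (_ : _ @^-1` B = \bigcup_(u in [set u : Y * Z | B (h u.1 u.2)])
    (f @^-1` [set u.1] `&` g @^-1` [set u.2])).
  apply: fin_bigcup_measurable => // u _; apply: measurableI.
    by rewrite -[X in measurable X]setTI; exact: mf.
  by rewrite -[X in measurable X]setTI; exact: mg.
apply/seteqP; split => [x Bx|x [u /= Bu [fu gu]]]; first by exists (f x, g x).
by rewrite /= fu gu.
Qed.

(* Probability measures on a finite discrete space Y, with the weak topology:
   the coarsest one making mu |-> \int f dmu continuous for every test function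
   f.  On a finite discrete space all real functions are bounded and continuous,
   so f ranges over all of them. *)
Section M1.
Context (R : realType).

Definition M1 (Y : nefinType) := probability (discrete Y) R.

Definition integrals (Y : nefinType) (mu : M1 Y) : {ptws (Y -> R) -> R} :=
  fun f => \int[mu]_y f y.

HB.instance Definition _ (Y : nefinType) := Pointed.on (M1 Y).
HB.instance Definition _ (Y : nefinType) :=
  Topological.copy (M1 Y) (initial_topology (@integrals Y)).

End M1.

Section kernels.
Context (R : realType).

(* Joint law of (x, y) when x ~ m and, given x, y ~ k x. *)
Section ksemidirect.
Context d d' (X : measurableType d) (Y : measurableType d').
Variables (m : probability X R) (k : R.-pker X ~> Y).

Definition semidirect (C : set (X * Y)) : \bar R :=
  (\int[m]_x k x (xsection C x))%E.

Let semidirect0 : semidirect set0 = 0%E.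
Proof.
by rewrite /semidirect integral0_eq// => x _; rewrite xsection0 measure0.
Qed.

Let semidirect_ge0 C : (0 <= semidirect C)%E.
Proof. by apply: integral_ge0 => x _. Qed.

Let semidirect_sigma_additive : semi_sigma_additive semidirect.
Proof.
move=> F mF tF mUF; rewrite /semidirect.
pose g i : X -> \bar R := fun x => k x (xsection (F i) x).
have mk i : measurable_fun [set: X] (g i).
  by apply: (measurable_fun_xsection_finite_kernel k); rewrite inE; exact: mF.
rewrite [X in _ --> X](_ : _ =
    \sum_(0 <= i <oo) (\int[m]_x k x (xsection (F i) x)))%E; last first.
  rewrite -integral_nneseries//.
  apply: eq_integral => x _; rewrite xsection_bigcup.
  apply/esym/cvg_lim => //.
  apply: (measure_semi_sigma_additive (fun i => xsection (F i) x)).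
  - by move=> i; exact: measurable_xsection.
  - exact: trivIset_xsection.
  - by apply: bigcupT_measurable => i; exact: measurable_xsection.
by apply: is_cvg_ereal_nneg_natsum => i _; apply: integral_ge0.
Qed.

HB.instance Definition _ := isMeasure.Build _ _ _ semidirect
  semidirect0 semidirect_ge0 semidirect_sigma_additive.

Let semidirectT : semidirect [set: X * Y] = 1%E.
Proof.
rewrite /semidirect (eq_integral (cst 1%E)).
  by rewrite integral_cst// mul1e; exact: probability_setT.
move=> x _; rewrite (_ : xsection _ _ = setT) ?prob_kernel//.
by apply/seteqP; split => // y _; rewrite /xsection/= inE.
Qed.

HB.instance Definition _ :=
  Measure_isProbability.Build _ _ _ semidirect semidirectT.

End ksemidirect.

Section kprecomp.
Context d d' d'' (W : measurableType d) (X : measurableType d')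
  (Y : measurableType d'').
Variables (k : R.-pker X ~> Y) (f : {mfun W >-> X}).

Definition kprecomp (w : W) : {measure set Y -> \bar R} := k (f w).

Let measurable_kprecomp U :
  measurable U -> measurable_fun [set: W] (kprecomp ^~ U).
Proof.
by move=> mU; apply: (measurableT_comp (measurable_kernel k U mU)).
Qed.

HB.instance Definition _ := isKernel.Build _ _ _ _ _ kprecomp
  measurable_kprecomp.

Let kprecompT w : kprecomp w [set: Y] = 1%E.
Proof. exact: prob_kernel. Qed.

HB.instance Definition _ := Kernel_isProbability.Build _ _ _ _ _ kprecomp
  kprecompT.

End kprecomp.

Section kdiscrete.
Context (Z Y : nefinType) (f : Z -> M1 R Y).

Definition kdiscrete (z : discrete Z) : {measure set (discrete Y) -> \bar R} :=
  f z.

HB.instance Definition _ := isKernel.Build _ _ _ _ _ kdiscrete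
  (fun U _ => @measurable_from_discrete _ _ _ (kdiscrete ^~ U)).

HB.instance Definition _ := Kernel_isProbability.Build _ _ _ _ _ kdiscrete
  (fun z => probability_setT (f z)).

End kdiscrete.
End kernels.

Section finite_law.
Context (R : realType) (Y : nefinType) (w : Y -> R).

Definition finite_law of (forall y, 0 <= w y) & \sum_y w y = 1 :=
  fun B : set (discrete Y) => (\sum_(y : Y) (w y)%:E * \d_(y : discrete Y) B)%E.

Hypotheses (w0 : forall y, 0 <= w y) (w1 : \sum_y w y = 1).
Local Notation mu := (finite_law w0 w1).

Let mu0 : mu set0 = 0%E.
Proof. by rewrite /finite_law big1// => y _; rewrite measure0 mule0. Qed.

Let mu_ge0 B : (0 <= mu B)%E.
Proof. by apply: sume_ge0 => y _; rewrite mule_ge0// lee_fin. Qed.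

Let mu_sigma_additive : semi_sigma_additive mu.
Proof.
move=> F mF tF mUF; rewrite /finite_law.
rewrite (_ : (fun n => _) = (fun n => (\sum_(y : Y) (w y)%:E *
    \sum_(0 <= i < n) \d_(y : discrete Y) (F i))%E)); last first.
  apply/funext => n; rewrite exchange_big/=; apply: eq_bigr => y _.
  by rewrite ge0_sume_distrr.
apply: cvg_nnesum => y _.
  by apply: nearW => n; rewrite mule_ge0 ?lee_fin// sume_ge0.
by apply: cvgeZl => //; exact: measure_semi_sigma_additive.
Qed.

HB.instance Definition _ := isMeasure.Build _ _ _ mu
  mu0 mu_ge0 mu_sigma_additive.

Let muT : mu setT = 1%E.
Proof.
rewrite /finite_law (eq_bigr (fun y => (w y)%:E)) ?sumEFin ?w1// => y _.
by rewrite diracT mule1.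
Qed.

HB.instance Definition _ := Measure_isProbability.Build _ _ _ mu muT.

End finite_law.

Section independent_product.
Context (R : realType) (I : finType) (Y : I -> nefinType).
Variable m : forall i, M1 R (Y i).

Definition mass (T : nefinType) (mu : M1 R T) (y : T) : R :=
  fine (mu [set (y : discrete T)]).

Lemma mass_ge0 (T : nefinType) (mu : M1 R T) y : 0 <= mass mu y.
Proof. exact: fine_ge0. Qed.

Lemma sum_mass (T : nefinType) (mu : M1 R T) : \sum_y mass mu y = 1.
Proof.
apply: EFin_inj; rewrite -sumEFin -(probability_setT mu).
transitivity (\sum_(y : T) mu [set (y : discrete T)])%E.
  by apply: eq_bigr => y _; rewrite fineK// fin_num_measure.
rewrite -big_enum fsbig_seq ?enum_uniq//= -measure_fin_bigcup//.
- congr (mu _); apply/seteqP; split => // y _; exists y => //=.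
  by rewrite mem_enum.
- by move=> x y _ _ [z [/= -> ->]].
Qed.

Let w (y : {dffun forall i, Y i}) : R := \prod_i mass (m i) (y i).

Lemma prod_mass_ge0 y : 0 <= w y.
Proof. by apply: prodr_ge0 => i _; exact: mass_ge0. Qed.

Lemma sum_prod_mass : \sum_y w y = 1.
Proof.
rewrite (reindex (@dffun_of_fprod I Y)); last first.
  exact/onW_bij/dffun_of_fprod_bij.
pose p i : {ffun Y i -> R} := [ffun y => mass (m i) y].
transitivity (\sum_(t : fprod Y) \prod_(i in I) p i (t i)).
  by apply: eq_bigr => t _; apply: eq_bigr => i _; rewrite !ffunE.
rewrite big_fprod -(bigA_distr_big_dep (fun i => tagged_with Y i)
  (fun i => untag 0 (p i))) big1// => i _.
rewrite -(big_tag (fun i y => p i y)) -[RHS](sum_mass (m i)).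
by apply: eq_bigr => y _; rewrite ffunE.
Qed.

Definition product_law : M1 R {dffun forall i, Y i} :=
  finite_law prod_mass_ge0 sum_prod_mass.

End independent_product.

(* A controlled process with hidden states in S, observations in O, actions in A.
   At each time t a control d : control t is drawn from a law depending on the
   record z : record t of past discrete events, and the action action_of z d is
   applied. *)
Record controller (R : realType) (O A : nefinType) := Controller {
  record : nat -> nefinType;
  control : nat -> nefinType;
  record_init : O -> record 0;
  record_next : forall t, record t -> control t -> O -> record t.+1;
  action_of : forall t, record t -> control t -> A;
  control_law : forall t, record t -> M1 R (control t) }.

Section controlled_process.
Context (R : realType) (S : ptopologicalType) (O A : nefinType).
Variables (P1 : probability (borel S * discrete O)%type R)
  (P : R.-pker (borel S * discrete A) ~> (borel S * discrete O)%type).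
Variable c : controller R O A.

(* States up to time t together with the record at time t. *)
Local Notation prefix t := (t.+1.-tuple (borel S) * discrete (record c t))%type.

Definition prefix_init (so : borel S * discrete O) : prefix 0 :=
  ([tuple so.1], record_init c so.2).

Definition prefix_next t
    (w : prefix t * discrete (control c t) * (borel S * discrete O)) :
  prefix t.+1 :=
  let: (ss, z, d, (s, o)) := w in (rcons_tuple ss s, record_next z d o).

Definition record_part t (w : prefix t) : discrete (record c t) := w.2.

Definition state_action t (w : prefix t * discrete (control c t)) :
  borel S * discrete A :=
  let: (ss, z, d) := w in (tnth ss ord_max, action_of z d).

Let measurable_prefix_init : measurable_fun [set: borel S * discrete O]
  prefix_init.
Proof.
apply/measurable_fun_pairP; split.
  apply/measurable_fun_tnthP => i.
  by rewrite (_ : _ \o _ = fst)//; apply/funext => -[s o]; rewrite ord1.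
apply: (measurableT_comp (@measurable_from_discrete _ O
  (discrete (record c 0)) (record_init c))).
exact: measurable_snd.
Qed.

HB.instance Definition _ :=
  isMeasurableFun.Build _ _ _ _ prefix_init measurable_prefix_init.

Let measurable_prefix_next t : measurable_fun setT (@prefix_next t).
Proof.
apply/measurable_fun_pairP; split.
  apply/measurable_fun_tnthP => i.
  have [it|it] := ltnP i t.+1.
    rewrite (_ : _ \o _ = (fun w => tnth w.1.1.1 (Ordinal it))).
      apply: (measurableT_comp (measurable_tnth (Ordinal it))).
      by do 2 apply: (measurableT_comp measurable_fst).
    apply/funext => -[[[ss z] d] [s o]] /=.
    by rewrite (tnth_nth s) [RHS](tnth_nth s)/= nth_rcons size_tuple it.
  rewrite (_ : _ \o _ = (fun w => w.2.1)).
    exact: (measurableT_comp measurable_fst).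
  apply/funext => -[[[ss z] d] [s o]] /=.
  rewrite (tnth_nth s)/= nth_rcons size_tuple ltnNge it/=.
  by rewrite eqn_leq it -ltnS ltn_ord.
pose zd (w : prefix t * discrete (control c t) * (borel S * discrete O)) :
  discrete (record c t * control c t)%type := (w.1.1.2, w.1.2).
rewrite (_ : _ \o _ = fun w => record_next (zd w).1 (zd w).2 w.2.2); last first.
  by apply/funext => -[[[ss z] d] [s o]].
refine (@measurable_discrete_pair _ _ (record c t * control c t)%type O
  (record c t.+1) zd (fun w => w.2.2) (fun y => record_next y.1 y.2) _ _).
  apply: (@measurable_discrete_pair _ _ _ _ _
    (fun w => w.1.1.2) (fun w => w.1.2) pair).
    apply: (measurableT_comp measurable_snd).
    by apply: (measurableT_comp measurable_fst); exact: measurable_fst.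
  by apply: (measurableT_comp measurable_snd); exact: measurable_fst.
by apply: (measurableT_comp measurable_snd); exact: measurable_snd.
Qed.

HB.instance Definition _ t :=
  isMeasurableFun.Build _ _ _ _ (@prefix_next t) (@measurable_prefix_next t).

Let measurable_record_part t : measurable_fun setT (@record_part t).
Proof. exact: measurable_snd. Qed.

HB.instance Definition _ t :=
  isMeasurableFun.Build _ _ _ _ (@record_part t) (@measurable_record_part t).

Let measurable_state_action t : measurable_fun setT (@state_action t).
Proof.
apply/measurable_fun_pairP; split.
  rewrite (_ : _ \o _ = fun w => tnth w.1.1 ord_max).
    apply: (measurableT_comp (measurable_tnth ord_max)).
    by apply: (measurableT_comp measurable_fst); exact: measurable_fst.
  by apply/funext => -[[ss z] d].
rewrite (_ : _ \o _ = fun w => action_of w.1.2 w.2); last first.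
  by apply/funext => -[[ss z] d].
apply: (@measurable_discrete_pair _ _ _ _ _
  (fun w => w.1.2) (fun w => w.2) (@action_of _ _ _ c t)).
  by apply: (measurableT_comp measurable_snd); exact: measurable_fst.
exact: measurable_snd.
Qed.

HB.instance Definition _ t :=
  isMeasurableFun.Build _ _ _ _ (@state_action t) (@measurable_state_action t).

Definition with_control t (m : probability (prefix t) R) :
    probability (prefix t * discrete (control c t))%type R :=
  semidirect m (kprecomp (kdiscrete (@control_law _ _ _ c t)) (@record_part t)).

(* The law of the process is given through its finite-horizon marginals: start
   from P1, then alternate the control law and the transition kernel P.  The
   prefix retains all past states. *)
Fixpoint prefix_law t : probability (prefix t) R :=
  if t is t'.+1 then
    distribution (semidirect (with_control (prefix_law t'))
                    (kprecomp P (@state_action t')))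
      (@prefix_next t')
  else distribution P1 prefix_init.

End controlled_process.

(* Time is 0-based: index t stands for the (t+1)-st stage, at which t.+1
   observations and t actions have been made. *)
Section model.
Context (N : nat) (O0 : nefinType) (On An : 'I_N -> nefinType).

Definition joint_obs : nefinType := (O0 * {dffun forall n, On n})%type.
Definition joint_act : nefinType := {dffun forall n, An n}.

Definition common_hist t : nefinType := t.+1.-tuple O0.
Definition private_hist n t : nefinType :=
  (t.+1.-tuple (On n) * t.-tuple (An n))%type.
Definition hist t : nefinType := (t.+1.-tuple joint_obs * t.-tuple joint_act)%type.

Definition common_part t (h : hist t) : common_hist t :=
  map_tuple (fun o : joint_obs => o.1) h.1.

Definition private_part n t (h : hist t) : private_hist n t :=
  (map_tuple (fun o : joint_obs => o.2 n) h.1,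
   map_tuple (fun a : joint_act => a n) h.2).

Definition hist_init (o : joint_obs) : hist 0 := ([tuple o], [tuple]).

Definition hist_next t (h : hist t) (a : joint_act) (o : joint_obs) : hist t.+1 :=
  (rcons_tuple h.1 o, rcons_tuple h.2 a).

Definition prescription t : nefinType :=
  {dffun forall n, {ffun private_hist n t -> An n}}.

Definition prescribed_act t (g : prescription t) (h : hist t) : joint_act :=
  [ffun n => g n (private_part n h)].

Fixpoint prescription_hist t : nefinType :=
  if t is t'.+1 then (prescription_hist t' * prescription t')%type else unit.

Context (R : realType).

Definition policy : Type :=
  prod_topology (fun n : 'I_N => prod_topology (fun t : nat =>
    prod_topology (fun h : common_hist t * private_hist n t => M1 R (An n)))).

(* The domains of the v t are finite and discrete, so that each v t is Borel
   measurable. *)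
Definition coordination : Type :=
  prod_topology (fun t : nat =>
    prod_topology (fun h : common_hist t * prescription_hist t =>
      M1 R (prescription t))).

HB.instance Definition _ := Topological.on policy.
HB.instance Definition _ := Topological.on coordination.

Definition is_dirac (Y : nefinType) (mu : M1 R Y) :=
  exists y : discrete Y, mu =1 \d_y.

Definition pure_policies : set policy :=
  [set u | forall n t h, is_dirac (u n t h)].

Definition pure_coordinations : set coordination :=
  [set v | forall t h, is_dirac (v t h)].

Definition pure_policy : Type := set_type pure_policies.
Definition pure_coordination : Type := set_type pure_coordinations.

HB.instance Definition _ := Topological.on pure_policy.
HB.instance Definition _ := Topological.on pure_coordination.

Lemma point_pure_policies :
  (fun n t h => \d_(point : discrete (An n)) : M1 R (An n)) \in pure_policies.
Proof. by apply/mem_set => n t h; exists point. Qed.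

Lemma point_pure_coordinations :
  (fun t h => \d_(point : discrete (prescription t)) : M1 R (prescription t))
    \in pure_coordinations.
Proof. by apply/mem_set => t h; exists point. Qed.

HB.instance Definition _ :=
  isPointed.Build pure_policy (SigSub point_pure_policies).
HB.instance Definition _ :=
  isPointed.Build pure_coordination (SigSub point_pure_coordinations).

Definition policy_controller (u : policy) : controller R joint_obs joint_act :=
  {| record := hist;
     control := fun=> joint_act;
     record_init := hist_init;
     record_next := hist_next;
     action_of := fun t h a => a;
     control_law := fun t h =>
       product_law (fun n => u n t (common_part h, private_part n h)) |}.

Definition coordination_controller (v : coordination) :
    controller R joint_obs joint_act :=
  {| record := fun t => (hist t * prescription_hist t)%type : nefinType;
     control := prescription;
     record_init := fun o => (hist_init o, tt);
     record_next := fun t z g o =>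
       (hist_next z.1 (prescribed_act g z.1) o, (z.2, g));
     action_of := fun t z g => prescribed_act g z.1;
     control_law := fun t z => v t (common_part z.1, z.2) |}.

Context (S : ptopologicalType).
(* As joint_obs is finite and discrete, a probability kernel to S * joint_obs is
   the same as a family P(s, a, B, o) that is measurable in (s, a, o) for each
   Borel set B, namely P (s, a) (B `*` [set o]). *)
Variables (P1 : probability (borel S * discrete joint_obs)%type R)
  (P : R.-pker (borel S * discrete joint_act) ~>
               (borel S * discrete joint_obs)%type).

Definition occupation := {t : nat & (hist t * joint_act)%type} -> \bar R.

Definition policy_prob (u : policy) : occupation := fun x =>
  let: existT t (h, a) := x in
  with_control (prefix_law P1 P (policy_controller u) t)
    [set w | w.1.2 = h /\ w.2 = a].

Definition coordination_prob (v : coordination) : occupation := fun x =>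
  let: existT t (h, a) := x in
  with_control (prefix_law P1 P (coordination_controller v) t)
    [set w | w.1.2.1 = h /\ prescribed_act w.2 w.1.2.1 = a].

Definition policy_occupation (mu : probability (borel pure_policy) R) :
  occupation := fun x => (\int[mu]_u policy_prob (set_val u) x)%E.

Definition coordination_occupation
    (nu : probability (borel pure_coordination) R) :
  occupation := fun x => (\int[nu]_v coordination_prob (set_val v) x)%E.

End model.

(* Main.v *)
Require Import Defs.
From HB Require Import structures.
From mathcomp Require Import all_boot all_order all_algebra.
From mathcomp Require Import all_classical all_reals all_analysis.
From mathcomp Require Import measurable_realfun.

(* Under a pure coordination the prescriptions are a function of the common
   history, which every agent can compute, so each agent can replay them and
   play its own component: this gives a pure policy with the same law of
   histories and actions.  Conversely a pure policy is a pure coordination that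
   ignores past prescriptions, and the first construction inverts this one.
   Both maps are continuous, because each coordinate of the image depends on
   finitely many coordinates, each locally constant on the pure policies; hence
   mixtures are transported by pushforward. *)

Set Implicit Arguments.
Unset Strict Implicit.
Unset Printing Implicit Defensive.

Import Order.TTheory GRing.Theory Num.Theory.
Import numFieldNormedType.Exports.

Local Open Scope classical_set_scope.
Local Open Scope ring_scope.

(** * Continuity, Borel measurability and change of variables *)

Lemma continuous_prod_topology (X : topologicalType) (I : Type)
    (K : I -> topologicalType) (f : X -> prod_topology K) :
  continuous f <-> forall i, continuous (fun x => f x i : K i).
Proof.
split=> [cf i x|cf x].
  have /cvg_sup/(_ i) fx := cf x.
  move=> B; rewrite /nbhs/=.
  move=> /(@initial_continuous _ _ (fun g : forall i, K i => g i) (f x)).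
  exact: fx.
apply/cvg_sup => i.
by apply: continuous_comp_initial; exact: cf.
Qed.

Lemma continuous_borel (X Y : ptopologicalType) (f : X -> Y) :
  continuous f -> measurable_fun setT (f : borel X -> borel Y).
Proof.
move=> /continuousP cf.
apply: (@measurability _ _ (borel X) (borel Y) setT f (@open Y)) => //.
by move=> _ [B oB <-]; rewrite setTI; apply: sub_sigma_algebra; exact: cf.
Qed.

Lemma continuous_locally_constant (X Y : topologicalType) (f : X -> Y) :
  (forall x, \forall x' \near x, f x' = f x) -> continuous f.
Proof.
move=> lf x B /nbhs_singleton Bfx.
by apply: filterS (lf x) => x' /= ->.
Qed.

(** Every preimage is open, whatever the sigma-algebra on [Y]; this serves for probabilities as
    functions of a pure policy. *)
Lemma measurable_locally_constant (X : ptopologicalType) d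
    (Y : measurableType d) (f : X -> Y) :
  (forall x, \forall x' \near x, f x' = f x) ->
  measurable_fun setT (f : borel X -> Y).
Proof.
move=> lf _ B _; rewrite setTI; apply: sub_sigma_algebra.
suff : open ((f : X -> Y) @^-1` B) by [].
rewrite openE => x Bx.
by apply: filterS (lf x) => x' /= ->.
Qed.

(** Change of variables for a measure [m'] known to be an image measure only through its values on
    measurable sets, as the simulation argument provides it. *)
Lemma ge0_integral_image_law d d' (R : realType) (X : measurableType d)
    (Y : measurableType d') (m : {measure set X -> \bar R})
    (m' : {measure set Y -> \bar R}) (f : X -> Y) (F : Y -> \bar R) :
  measurable_fun setT f -> (forall C, measurable C -> m' C = m (f @^-1` C)) ->
  measurable_fun setT F -> (forall y, 0 <= F y)%E ->
  (\int[m']_y F y = \int[m]_x F (f x))%E.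
Proof.
move=> mf m'E mF F0.
pose fm : {mfun X >-> Y} := HB.pack f (isMeasurableFun.Build _ _ _ _ f mf).
rewrite (eq_measure_integral (pushforward m fm)); last first.
  by move=> C mC _; exact: m'E.
by rewrite ge0_integral_pushforward.
Qed.

Lemma measurable_discrete_snd d (X : measurableType d) (Z : nefinType)
    (B : set Z) : measurable [set w : X * discrete Z | B w.2].
Proof.
rewrite -[X in measurable X]setTI.
exact: (@measurable_snd _ _ X (discrete Z)).
Qed.

Lemma measurable_discrete_snd2 d (X : measurableType d) (Z Y : nefinType)
    (B : set (Z * Y)) :
  measurable [set w : X * discrete Z * discrete Y | B (w.1.2, w.2)].
Proof.
have mf : measurable_fun setT (fun w : X * discrete Z * discrete Y =>
    (w.1.2, w.2) : discrete (Z * Y)%type).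
  apply: measurable_discrete_pair => //.
  exact: (measurableT_comp measurable_snd).
rewrite -[X in measurable X]setTI; exact: mf.
Qed.

(** * Semidirect products with deterministic kernels *)

Section deterministic_kernel.
Context d d' (R : realType) (X : measurableType d) (Y : measurableType d').
Variables (m : probability X R) (k : R.-pker X ~> Y) (f : X -> Y).
Hypothesis mf : measurable_fun setT f.
Hypothesis kf : forall x, k x =1 \d_(f x).

Let measurable_graph : measurable_fun setT (fun x => (x, f x)).
Proof. exact: measurable_fun_pair. Qed.

(** The joint law is carried by the graph of [f]: the kernel mass of the section of [C] at [x] is
    the indicator of [C (x, f x)]. *)
Lemma semidirect_dirac C : measurable C ->
  semidirect m k C = m [set x | C (x, f x)].
Proof.
move=> mC; rewrite /semidirect.
rewrite (eq_integral (EFin \o \1_[set x | C (x, f x)])); last first.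
  move=> x _; rewrite kf /= diracE indicE; congr ((nat_of_bool _)%:R%:E).
  by apply/idP/idP; rewrite !inE /xsection /= !inE.
rewrite integral_indic//= ?setIT// -[X in measurable X]setTI.
exact: measurable_graph.
Qed.

Lemma integral_semidirect_dirac (F : X * Y -> \bar R) :
  measurable_fun setT F -> (forall x, 0 <= F x)%E ->
  (\int[semidirect m k]_x F x = \int[m]_x F (x, f x))%E.
Proof.
move=> mF F0; apply: (ge0_integral_image_law measurable_graph) => // C mC.
exact: semidirect_dirac.
Qed.

End deterministic_kernel.

(** * Controlled processes with deterministic controls *)

Section deterministic_process.
Context (R : realType) (S : ptopologicalType) (O A : nefinType).
Variables (P1 : probability (borel S * discrete O)%type R)
  (P : R.-pker (borel S * discrete A) ~> (borel S * discrete O)%type).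

Local Notation prefix c t :=
  (t.+1.-tuple (borel S) * discrete (record c t))%type.

Definition feedback (c : controller R O A)
    (g : forall t, record c t -> control c t) t (w : prefix c t) :
  discrete (control c t) := g t w.2.

Lemma measurable_feedback (c : controller R O A)
    (g : forall t, record c t -> control c t) t :
  measurable_fun setT (feedback g (t := t)).
Proof.
apply: (measurableT_comp (@measurable_from_discrete _ (record c t)
  (discrete (control c t)) (g t))); exact: measurable_snd.
Qed.

Definition deterministic (c : controller R O A)
    (g : forall t, record c t -> control c t) :=
  forall t z, control_law z =1 \d_(g t z : discrete (control c t)).

Lemma with_control_dirac (c : controller R O A)
    (g : forall t, record c t -> control c t) t C :
  deterministic g -> measurable C ->
  with_control (prefix_law P1 P c t) C =
  prefix_law P1 P c t [set w | C (w, feedback g w)].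
Proof.
move=> hg mC; rewrite /with_control.
apply: semidirect_dirac => //; first exact: measurable_feedback.
by move=> w; exact: hg.
Qed.

(** Conditional probability that the next prefix lies in [C], given the current prefix and
    control. *)
Definition step_prob (c : controller R O A) t (C : set (prefix c t.+1))
    (x : prefix c t * discrete (control c t)) : \bar R :=
  P (state_action x) (xsection (@prefix_next _ _ _ _ c t @^-1` C) x).

Lemma measurable_step_prob (c : controller R O A) t (C : set (prefix c t.+1)) :
  measurable C -> measurable_fun setT (step_prob C).
Proof.
move=> mC; apply: (measurable_fun_xsection_finite_kernel
  (kprecomp P (@state_action _ _ _ _ c t))).
rewrite inE -[X in measurable X]setTI; exact: measurable_funPT.
Qed.

Lemma prefix_lawS_dirac (c : controller R O A)
    (g : forall t, record c t -> control c t) t C :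
  deterministic g -> measurable C ->
  (prefix_law P1 P c t.+1 C =
   \int[prefix_law P1 P c t]_w step_prob C (w, feedback g w))%E.
Proof.
move=> hg mC.
(* This equality is the definition of [prefix_law] at [t.+1], unfolded; the Dirac kernel then
   removes the control variable. *)
transitivity (\int[with_control (prefix_law P1 P c t)]_x step_prob C x)%E => //.
apply: integral_semidirect_dirac => //.
- exact: measurable_feedback.
- by move=> w; exact: hg.
- exact: measurable_step_prob.
Qed.

Section simulation.
Variables c c' : controller R O A.
Variables (g : forall t, record c t -> control c t)
  (g' : forall t, record c' t -> control c' t)
  (r : forall t, record c t -> record c' t).
Hypotheses (hg : deterministic g) (hg' : deterministic g').
Hypothesis r_init : forall o, r (record_init c o) = record_init c' o.

Definition map_record t (w : prefix c t) : prefix c' t := (w.1, r w.2).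

Lemma measurable_map_record t : measurable_fun setT (@map_record t).
Proof.
apply: measurable_fun_pair; first exact: measurable_fst.
apply: (measurableT_comp (@measurable_from_discrete _ (record c t)
  (discrete (record c' t)) (@r t))); exact: measurable_snd.
Qed.

(* Only times [t < T] are constrained, so that policies agreeing up to [T] can
   be compared through [r := id]. *)
Lemma prefix_law_simulation T :
  (forall t (z : record c t), (t < T)%N ->
    action_of z (g z) = action_of (r z) (g' (r z))) ->
  (forall t (z : record c t) o, (t < T)%N ->
    r (record_next z (g z) o) = record_next (r z) (g' (r z)) o) ->
  forall C, measurable C ->
  prefix_law P1 P c' T C = prefix_law P1 P c T (@map_record T @^-1` C).
Proof.
elim: T => [|t IH] r_act r_next C mC.
  rewrite /= /distribution /pushforward; congr (P1 _).
  by apply/seteqP; split=> -[s o]; rewrite /prefix_init /map_record /= r_init.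
have mrC : measurable (@map_record t.+1 @^-1` C).
  rewrite -[X in measurable X]setTI; exact: measurable_map_record.
rewrite (prefix_lawS_dirac hg')// (prefix_lawS_dirac hg)//.
(* By induction the law for [c'] at time [t] is the image under [map_record] of the law for [c], so
   both sides are integrals over prefixes of [c]. The integrands agree: [r_act] gives [P] the same
   argument, [r_next] the same set of next states and observations. *)
rewrite (@ge0_integral_image_law _ _ _ _ _ (prefix_law P1 P c t) _
  (@map_record t))//=.
- apply: eq_integral => -[ss z] _ /=.
  rewrite /step_prob /feedback /state_action/= r_act//.
  congr (P _ _); apply/seteqP; split => -[s o];
    by rewrite /xsection /= /map_record /= !inE /= r_next.
- exact: measurable_map_record.
- move=> B mB; apply: IH => // [s z st|s z o st].
    by apply: r_act; exact: ltnW.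
  by apply: r_next; exact: ltnW.
- apply: (measurableT_comp (measurable_step_prob mC)).
  by apply: measurable_fun_pair => //; exact: measurable_feedback.
Qed.

End simulation.
End deterministic_process.

(** * Dirac measures on finite sets and their atoms *)

Section atoms.
Context (R : realType).

(* Meaningless unless [mu] is a Dirac measure. *)
Definition atom (Y : nefinType) (mu : M1 R Y) : Y :=
  xget point [set y : Y | mu =1 \d_(y : discrete Y)].

Lemma atomP (Y : nefinType) (mu : M1 R Y) :
  is_dirac mu -> mu =1 \d_(atom mu : discrete Y).
Proof.
exact: (@xgetPex Y point [set y : Y | mu =1 \d_(y : discrete Y)]).
Qed.

Lemma dirac_discrete1 (Y : nefinType) (x y : Y) :
  (\d_(x : discrete Y) [set (y : discrete Y)] : \bar R) = (x == y)%:R%:E.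
Proof.
rewrite diracE; congr ((nat_of_bool _)%:R%:E).
by apply/idP/eqP; rewrite inE.
Qed.

Lemma atom_dirac (Y : nefinType) (mu : M1 R Y) y :
  mu =1 \d_(y : discrete Y) -> atom mu = y.
Proof.
move=> muy; have /atomP mua : is_dirac mu by exists y.
have := muy [set (y : discrete Y)].
rewrite mua !dirac_discrete1 eqxx => -[].
by case: eqVneq => //= _ /esym/eqP; rewrite oner_eq0.
Qed.

(** A tuple that differs from [a] in some coordinate has a zero factor in its weight, so only [a] is
    charged. *)
Lemma product_law_dirac (I : finType) (Y : I -> nefinType)
    (m : forall i, M1 R (Y i)) (a : forall i, Y i) :
  (forall i, m i =1 \d_(a i : discrete (Y i))) ->
  product_law m =1 \d_([ffun i => a i] : discrete {dffun forall i, Y i}).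
Proof.
move=> ma B; rewrite /product_law /= /finite_law.
pose a' : ({dffun forall i, Y i} : nefinType) := [ffun i => a i].
rewrite (bigD1 a')//= [X in (_ + X)%E]big1 ?adde0 => [|y ya].
  rewrite big1 ?mul1e// => i _.
  by rewrite /mass ma ffunE dirac_discrete1 eqxx.
have [i yi] : exists i, y i != a i.
  apply/existsP; apply: contraR ya; rewrite negb_exists => /forallP ya.
  by apply/eqP/ffunP => i; rewrite ffunE; apply/eqP; rewrite -[_ == _]negbK.
rewrite (bigD1 i)//= /mass ma dirac_discrete1 eq_sym (negbTE yi) mul0r mul0e//.
Qed.

(** The mass of a fixed point is weakly continuous, being the integral of an indicator. On Dirac
    measures it is 0 or 1, so where it stays positive the atom cannot move. *)
Lemma near_eq_atom (X : topologicalType) (Y : nefinType) (f : X -> M1 R Y) :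
  continuous f -> (forall x, is_dirac (f x)) ->
  forall x, \forall x' \near x, atom (f x') = atom (f x).
Proof.
move=> cf df x; set y := atom (f x).
pose e (mu : M1 R Y) := \int[mu]_z (\1_[set (y : discrete Y)] z : R).
have ce : continuous e.
  have /continuous_prod_topology := @initial_continuous _ _ (@integrals R Y).
  exact.
have ef x' : e (f x') = (atom (f x') == y)%:R.
  rewrite /e /Rintegral (eq_measure_integral (\d_(atom (f x') : discrete Y)));
    last by move=> B _ _; exact: atomP.
  rewrite integral_dirac// diracT mul1e/= indicE; congr ((nat_of_bool _)%:R).
  by apply/idP/eqP; rewrite inE.
have : \forall x' \near x, 0 < e (f x').
  apply: (@cvgr_gt _ _ _ _ (e \o f) (e (f x))).
    by apply: continuous_comp; [exact: cf|exact: ce].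
  by rewrite ef eqxx.
apply: filterS => x'; rewrite ef; case: eqVneq => //=.
by rewrite ltxx.
Qed.

End atoms.

(** * Translations between policies and coordinations *)

Section strategies.
Context (R : realType) (N : nat) (O0 : nefinType) (On An : 'I_N -> nefinType).
Local Notation policy := (policy O0 On An R).
Local Notation coordination := (coordination O0 On An R).
Local Notation hist := (hist O0 On An).

(** Removes the latest observation: [belast x s] is [x :: s] without its last entry. *)
Definition past t (h : common_hist O0 t.+1) : common_hist O0 t :=
  [tuple of belast (thead h) (behead h)].

Lemma past_common_part t (h : hist t) a o :
  past (common_part (hist_next h a o)) = common_part h.
Proof.
apply: val_inj; case: h => -[[|x s]// ss] al /=.
by rewrite /thead (tnth_nth x.1) /= map_rcons belast_rcons.
Qed.

(** The prescription of stage [t'] was chosen before the last observation in [h] arrived, hence the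
    evaluation at [past h]. *)
Fixpoint replay (v : coordination) t :
    common_hist O0 t -> prescription_hist On An t :=
  if t is t'.+1 return common_hist O0 t -> prescription_hist On An t
  then fun h => let h' := past h in
    (replay v h', atom (v t' (h', replay v h')))
  else fun=> tt.

Definition decentralize (v : coordination) : policy :=
  fun n t h => \d_((atom (v t (h.1, replay v h.1)) n h.2) : discrete (An n)).

Arguments decentralize : clear implicits.

Definition joint_prescription (u : policy) t (h : common_hist O0 t) :
    prescription On An t :=
  [ffun n => [ffun k => atom (u n t (h, k))]].

Definition coordinate (u : policy) : coordination :=
  fun t h => \d_(joint_prescription u h.1 : discrete (prescription On An t)).

Arguments coordinate : clear implicits.

Lemma decentralize_pure v : pure_policies (decentralize v).
Proof. by move=> n t h; eexists. Qed.

Lemma coordinate_pure u : pure_coordinations (coordinate u).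
Proof. by move=> t h; eexists. Qed.

Lemma atom_decentralize v n t h :
  atom (decentralize v n t h) = atom (v t (h.1, replay v h.1)) n h.2.
Proof. exact: atom_dirac. Qed.

Lemma atom_coordinate u t h :
  atom (coordinate u t h) = joint_prescription u h.1.
Proof. exact: atom_dirac. Qed.

(** The round trip is stated on atoms, which are all that the law of a pure policy depends on. *)
Lemma atom_decentralizeK u n t h :
  atom (decentralize (coordinate u) n t h) = atom (u n t h).
Proof.
by rewrite atom_decentralize atom_coordinate !ffunE; case: h.
Qed.

Definition played (u : policy) t (h : hist t) : joint_act An :=
  [ffun n => atom (u n t (common_part h, private_part n h))].

Definition prescribed (v : coordination) t
    (z : record (coordination_controller v) t) : prescription On An t :=
  atom (v t (common_part z.1, z.2)).

Lemma deterministic_policy u : pure_policies u ->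
  deterministic (c := policy_controller u) (played u).
Proof.
move=> pu t z; apply: product_law_dirac => n; exact: atomP.
Qed.

Lemma deterministic_coordination v : pure_coordinations v ->
  deterministic (@prescribed v).
Proof. by move=> pv t z B; rewrite (atomP (pv _ _)). Qed.

Local Notation PP := (pure_policy O0 On An R).
Local Notation PC := (pure_coordination O0 On An R).

Lemma near_policy_atom n t h (u : PP) :
  \forall u' \near u, atom (set_val u' n t h) = atom (set_val u n t h).
Proof.
apply: (@near_eq_atom _ _ _ (fun u : PP => set_val u n t h)).
  have c0 : continuous (set_val : PP -> policy).
    exact: initial_continuous.
  by move: c0 => /continuous_prod_topology/(_ n)
    /continuous_prod_topology/(_ t)/continuous_prod_topology/(_ h).
by move=> {}u; have := set_valP u; apply.
Qed.

Lemma near_coordination_atom t h (v : PC) :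
  \forall v' \near v, atom (set_val v' t h) = atom (set_val v t h).
Proof.
apply: (@near_eq_atom _ _ _ (fun v : PC => set_val v t h)).
  have c0 : continuous (set_val : PC -> coordination).
    exact: initial_continuous.
  by move: c0 => /continuous_prod_topology/(_ t)
    /continuous_prod_topology/(_ h).
by move=> {}v; have := set_valP v; apply.
Qed.

(** The point at which [v t] is evaluated depends on [v] itself. By induction this point is locally
    constant, and then a single coordinate of [v] is left to control. *)
Lemma near_replay t h (v : PC) :
  \forall v' \near v,
    replay (set_val v') h = replay (set_val v) h :> prescription_hist On An t.
Proof.
elim: t h => [|t IH] h; first by near=> v'.
near=> v' => /=.
have -> : replay (set_val v') (past h) = replay (set_val v) (past h).
  by near: v'; exact: IH.
congr (_, _).
by near: v'; exact: near_coordination_atom.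
Unshelve. all: end_near. Qed.

Definition pure_decentralize (v : PC) : PP :=
  SigSub (mem_set (@decentralize_pure (set_val v))).

Definition pure_coordinate (u : PP) : PC :=
  SigSub (mem_set (@coordinate_pure (set_val u))).

Lemma continuous_pure_decentralize : continuous pure_decentralize.
Proof.
apply: continuous_comp_initial.
apply/continuous_prod_topology => n; apply/continuous_prod_topology => t.
apply/continuous_prod_topology => h; apply: continuous_locally_constant => v.
near=> v'.
suff : decentralize (set_val v') n t h = decentralize (set_val v) n t h by [].
rewrite /decentralize.
have -> : replay (set_val v') h.1 = replay (set_val v) h.1.
  by near: v'; exact: near_replay.
have -> // : atom (set_val v' t (h.1, replay (set_val v) h.1)) =
  atom (set_val v t (h.1, replay (set_val v) h.1)).
by near: v'; exact: near_coordination_atom.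
Unshelve. all: end_near. Qed.

Lemma continuous_pure_coordinate : continuous pure_coordinate.
Proof.
apply: continuous_comp_initial.
apply/continuous_prod_topology => t.
apply/continuous_prod_topology => h; apply: continuous_locally_constant => u.
(* A prescription records the choices of all agents at all private histories, so agreement is needed
   for all [n] and [k] at once; both range over finite sets, so finitely many neighbourhoods are
   intersected. *)
have : \forall u' \near u, forall n k,
    atom (set_val u' n t (h.1, k)) = atom (set_val u n t (h.1, k)).
  apply: (@filter_forall _ _ _ (nbhs u)) => n.
  apply: (@filter_forall _ _ _ (nbhs u)) => k; exact: near_policy_atom.
apply: filterS => u' uu'.
suff : coordinate (set_val u') t h = coordinate (set_val u) t h by [].
rewrite /coordinate; have -> // : joint_prescription (set_val u') h.1 =
  joint_prescription (set_val u) h.1.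
by apply/ffunP => n; apply/ffunP => k; rewrite !ffunE uu'.
Qed.

Definition decentralize_mfun : {mfun borel PC >-> borel PP} :=
  HB.pack (pure_decentralize : borel PC -> borel PP)
    (isMeasurableFun.Build _ _ _ _ (pure_decentralize : borel PC -> borel PP)
      (continuous_borel continuous_pure_decentralize)).

Definition coordinate_mfun : {mfun borel PP >-> borel PC} :=
  HB.pack (pure_coordinate : borel PP -> borel PC)
    (isMeasurableFun.Build _ _ _ _ (pure_coordinate : borel PP -> borel PC)
      (continuous_borel continuous_pure_coordinate)).

(** * Comparison of history-action probabilities and of mixtures *)

Context (S : ptopologicalType).
Variables (P1 : probability (borel S * discrete (joint_obs O0 On))%type R)
  (P : R.-pker (borel S * discrete (joint_act An)) ~>
               (borel S * discrete (joint_obs O0 On))%type).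

(** The action is a function of the history, so the event concerns the record alone. *)
Lemma policy_prob_pure u t h a : pure_policies u ->
  policy_prob P1 P u (existT _ t (h, a)) =
  prefix_law P1 P (policy_controller u) t
    [set w | w.2 = h /\ played u h = a].
Proof.
move=> pu; rewrite /policy_prob
  (with_control_dirac _ _ (deterministic_policy pu)).
  by congr (prefix_law _ _ _ _ _); apply/seteqP; split => w;
    rewrite /feedback /=; move=> [<- <-].
exact: (@measurable_discrete_snd2 _ _ (hist t) (joint_act An)
  (fun w => w.1 = h /\ w.2 = a)).
Qed.

Lemma coordination_prob_pure v t h a : pure_coordinations v ->
  coordination_prob P1 P v (existT _ t (h, a)) =
  prefix_law P1 P (coordination_controller v) t
    [set w | w.2.1 = h /\ prescribed_act (prescribed (v := v) w.2) h = a].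
Proof.
move=> pv; rewrite /coordination_prob
  (with_control_dirac _ _ (deterministic_coordination pv)).
  by congr (prefix_law _ _ _ _ _); apply/seteqP; split => w;
    rewrite /feedback /=; move=> [<- <-].
exact: (@measurable_discrete_snd2 _ _ _ (prescription On An t)
  (fun w => w.1.1 = h /\ prescribed_act w.2 w.1.1 = a)).
Qed.

(** Simulation with the identity on records. Reaching the history takes agreement at times before
    [t]; the bound [t.+1] adds the action played at [t]. *)
Lemma eq_policy_prob u u' t x : pure_policies u -> pure_policies u' ->
  (forall s n h, (s < t.+1)%N -> atom (u n s h) = atom (u' n s h)) ->
  policy_prob P1 P u (existT _ t x) = policy_prob P1 P u' (existT _ t x).
Proof.
case: x => h a pu pu' uu'; rewrite !policy_prob_pure//.
have uu s (k : hist s) : (s < t.+1)%N -> played u k = played u' k.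
  by move=> st; apply/ffunP => n; rewrite !ffunE uu'.
apply/esym; etransitivity.
  apply: (@prefix_law_simulation R S _ _ P1 P
    (policy_controller u) (policy_controller u') _ _ (fun _ => id)
    (deterministic_policy pu) (deterministic_policy pu')) => //.
  - by move=> s z st /=; rewrite uu// ltnW.
  - by move=> s z o st /=; rewrite uu// ltnW.
  - exact: (@measurable_discrete_snd _ _ _ (fun z => z = h /\ played u' h = a)).
by rewrite -uu.
Qed.

Lemma policy_prob_decentralize v x : pure_coordinations v ->
  policy_prob P1 P (decentralize v) x = coordination_prob P1 P v x.
Proof.
move=> pv; case: x => t [h a].
rewrite policy_prob_pure ?coordination_prob_pure//;
  last exact: decentralize_pure.
have act s (k : hist s) : played (decentralize v) k =
    prescribed_act (prescribed (v := v) (k, replay v (common_part k))) k.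
  by apply/ffunP => n; rewrite !ffunE atom_decentralize.
apply/esym; etransitivity.
  (* The simulation attaches to each history its replayed prescriptions. The pairing survives each
     step because appending an observation and then taking [past] recovers the earlier common
     history. *)
  apply: (@prefix_law_simulation R S _ _ P1 P
    (policy_controller (decentralize v)) (coordination_controller v) _ _
    (fun s (k : hist s) => (k, replay v (common_part k)))
    (deterministic_policy (@decentralize_pure v))
    (deterministic_coordination pv)) => //.
  - by move=> s z st /=; rewrite act.
  - by move=> s z o st /=; rewrite past_common_part act.
  - exact: (@measurable_discrete_snd _ _ _
      (fun z => z.1 = h /\ prescribed_act (prescribed (v := v) z) h = a)).
congr (prefix_law _ _ _ _ _); apply/seteqP; split => -[ss z] /=;
  by rewrite act => -[<- <-].
Qed.

Lemma measurable_policy_prob x :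
  measurable_fun setT (fun u : borel PP => policy_prob P1 P (set_val u) x).
Proof.
apply: measurable_locally_constant => u; case: x => t ha.
(* Bounding time by ['I_t.+1] leaves finitely many atoms to fix, so the set is a neighbourhood. *)
have : nbhs u [set u' : PP | forall (s : 'I_t.+1) n h,
    atom (set_val u' n s h) = atom (set_val u n s h)].
  apply: (@filter_forall _ _ _ (nbhs u)) => s.
  apply: (@filter_forall _ _ _ (nbhs u)) => n.
  by apply: (@filter_forall _ _ _ (nbhs u)) => h; exact: near_policy_atom.
apply: filterS => u' uu'; apply: eq_policy_prob; try exact: set_valP.
by move=> s n h st; exact: (uu' (Ordinal st)).
Qed.

Lemma policy_prob_ge0 u x : (0 <= policy_prob P1 P u x)%E.
Proof. by case: x => t [h a]; exact: measure_ge0. Qed.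

Lemma coordination_prob_ge0 v x : (0 <= coordination_prob P1 P v x)%E.
Proof. by case: x => t [h a]; exact: measure_ge0. Qed.

(** Inherited from the policy side: on pure coordinations this function is [policy_prob] composed
    with the continuous map [pure_decentralize]. *)
Lemma measurable_coordination_prob x :
  measurable_fun setT
    (fun v : borel PC => coordination_prob P1 P (set_val v) x).
Proof.
have := measurableT_comp (measurable_policy_prob x)
  (continuous_borel continuous_pure_decentralize).
apply: eq_measurable_fun => v _ /=.
by rewrite policy_prob_decentralize//; exact: set_valP.
Qed.

(** No second simulation is made: decentralizing [coordinate u] preserves its probabilities and
    gives back the atoms of [u]. *)
Lemma coordination_prob_coordinate u x : pure_policies u ->
  coordination_prob P1 P (coordinate u) x = policy_prob P1 P u x.
Proof.
move=> pu; rewrite -policy_prob_decentralize; last exact: coordinate_pure.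
case: x => t ha; apply: eq_policy_prob => //; first exact: decentralize_pure.
by move=> s n h _; exact: atom_decentralizeK.
Qed.

Lemma policy_occupationE (nu : probability (borel PC) R) :
  policy_occupation P1 P (distribution nu decentralize_mfun) =
  coordination_occupation P1 P nu.
Proof.
apply/funext => x; rewrite /policy_occupation.
rewrite (@ge0_integral_image_law _ _ _ _ _ nu _
  (pure_decentralize : borel PC -> borel PP))//.
- by apply: eq_integral => v _; rewrite policy_prob_decentralize//;
    exact: set_valP.
- exact: continuous_borel continuous_pure_decentralize.
- exact: measurable_policy_prob.
- by move=> u; exact: policy_prob_ge0.
Qed.

Lemma coordination_occupationE (mu : probability (borel PP) R) :
  coordination_occupation P1 P (distribution mu coordinate_mfun) =
  policy_occupation P1 P mu.
Proof.
apply/funext => x; rewrite /coordination_occupation.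
rewrite (@ge0_integral_image_law _ _ _ _ _ mu _
  (pure_coordinate : borel PP -> borel PC))//.
- by apply: eq_integral => u _; rewrite coordination_prob_coordinate//;
    exact: set_valP.
- exact: continuous_borel continuous_pure_coordinate.
- exact: measurable_coordination_prob.
- by move=> v; exact: coordination_prob_ge0.
Qed.

End strategies.

Theorem theorem5 (R : realType) (N : nat)
    (O0 : nefinType) (On An : 'I_N -> nefinType) (S : ptopologicalType)
    (P1 : probability (borel S * discrete (joint_obs O0 On))%type R)
    (P : R.-pker (borel S * discrete (joint_act An)) ~>
                 (borel S * discrete (joint_obs O0 On))%type) :
  range (fun mu : probability (borel (pure_policy O0 On An R)) R =>
           policy_occupation P1 P mu) =
  range (fun nu : probability (borel (pure_coordination O0 On An R)) R =>
           coordination_occupation P1 P nu).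
Proof.
apply/seteqP; split=> _ [m _ <-].
- exists (distribution m (coordinate_mfun _ _ _ _)) => //.
  exact: coordination_occupationE.
- exists (distribution m (decentralize_mfun _ _ _ _)) => //.
  exact: policy_occupationE.
Qed.
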